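(* Let $\approx$ be an equinumerosity on $\mathbb W$, let $\mathfrak N=\mathbb W/\approx$ and let $\mathfrak n:\mathbb W\to\mathfrak N$ be the canonical map. Then there exist unique binary operations $+$ and $\cdot$ on $\mathfrak N$ and a unique linear order $<$ on $\mathfrak N$ such that for all $X,Y\in\mathbb W$: (1) $\mathfrak n(X)+\mathfrak n(Y)=\mathfrak n(X\cup Y)$ whenever $X\cap Y=\emptyset$; (2) $\mathfrak n(X)\cdot\mathfrak n(Y)=\mathfrak n(X\times Y)$ whenever $X,Y$ are multipliable; (3) $\mathfrak n(X)<\mathfrak n(Y)$ if and only if $Y\approx Y'$ for some proper superset $Y'\in\mathbb W$ of $X$. The resulting structure on $\mathfrak N$ is the non-negative part of a discretely ordered ring $(\mathfrak R,0,1,+,\cdot,<)$. Moreover, if the prime subring of $\mathfrak R$ (generated by $1$) is identified with $\mathbb Z$, then $\mathfrak n(X)=|X|$ for every finite $X\in\mathbb W$.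
   Context: Let $\mathbb N=\{0,1,2,\dots\}$. Let $\mathbb{W}$ be the family of finitary point sets: sets $A\subseteq\bigcup_{k\ge1}\mathbb N^k$ of finite tuples of natural numbers (tuples of different lengths allowed) such that for every $n\in\mathbb N$ there is $h$ with $A\cap\{0,\dots,n\}^k=\emptyset$ for all $k>h$. Cartesian products are identified with concatenations: $A\times B=\{(a_1,\dots,a_k,b_1,\dots,b_h):(a_1,\dots,a_k)\in A,\ (b_1,\dots,b_h)\in B\}$; $\{n\}$ denotes the set whose only element is the 1-tuple $(n)$. $A,B\in\mathbb W$ are multipliable if distinct pairs $(a,b)\in A\times B$ have distinct concatenations. Given an equivalence relation $\approx$ on $\mathbb W$, write $A\succ B$, equivalently $B\prec A$, if there exist $A',B'\in\mathbb W$ with $B'\subsetneq A'$, $A\approx A'$ and $B\approx B'$. An equinumerosity is an equivalence relation $\approx$ on $\mathbb W$ such that for all $A,B\in\mathbb W$: (AP) $A\approx B$ iff $A\setminus B\approx B\setminus A$; (ZP) exactly one of $A\approx B$, $A\succ B$, $A\prec B$ holds; (TP) if $T$ is injective on $A$ and $T(a)$ is a permutation of the coordinates of $a$ for every $a\in A$, then $A\approx T[A]$; (UP) $A\times\{n\}\approx A$ for all $n\in\mathbb N$; (PP) if $A,B$ are multipliable, $A',B'$ are multipliable, $A\approx A'$ and $B\approx B'$, then $A\times B\approx A'\times B'$. *)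

(* Defs.v *)
From HB Require Import structures.
From mathcomp Require Import all_boot all_order all_algebra.
Set Implicit Arguments. Unset Strict Implicit. Unset Printing Implicit Defensive.
Import Order.TTheory GRing.Theory Num.Theory.

(* Points are finite tuples of naturals, represented as [seq nat];
   point sets are predicates on them. *)
Definition pset := seq nat -> Prop.

Definition inW (A : pset) : Prop :=
  (forall a, A a -> a <> [::]) /\
  (forall n : nat, exists h : nat,
     forall a, A a -> all (fun x => x <= n) a -> size a <= h).

Definition psubset (A B : pset) : Prop := forall a, A a -> B a.
Definition pproper (B A : pset) : Prop := psubset B A /\ exists a, A a /\ ~ B a.
Definition punion (A B : pset) : pset := fun a => A a \/ B a.
Definition pdiff (A B : pset) : pset := fun a => A a /\ ~ B a.
Definition pdisjoint (A B : pset) : Prop := forall a, ~ (A a /\ B a).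
Definition pprod (A B : pset) : pset :=
  fun c => exists a b, A a /\ B b /\ c = a ++ b.
Definition psing (n : nat) : pset := fun a => a = [:: n].
Definition pimage (T : seq nat -> seq nat) (A : pset) : pset :=
  fun c => exists a, A a /\ c = T a.

Definition multipliable (A B : pset) : Prop :=
  forall a b a' b', A a -> B b -> A a' -> B b' ->
    a ++ b = a' ++ b' -> a = a' /\ b = b'.

Definition succ (approx : pset -> pset -> Prop) (A B : pset) : Prop :=
  exists A' B', inW A' /\ inW B' /\ pproper B' A' /\ approx A A' /\ approx B B'.

Definition exactly_one (P Q R : Prop) : Prop :=
  (P \/ Q \/ R) /\ ~ (P /\ Q) /\ ~ (P /\ R) /\ ~ (Q /\ R).

Definition equinumerosity (approx : pset -> pset -> Prop) : Prop :=
  (forall A, inW A -> approx A A) /\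
  (forall A B, inW A -> inW B -> approx A B -> approx B A) /\
  (forall A B C, inW A -> inW B -> inW C -> approx A B -> approx B C -> approx A C) /\
  (forall A B, inW A -> inW B -> (approx A B <-> approx (pdiff A B) (pdiff B A))) /\
  (forall A B, inW A -> inW B ->
     exactly_one (approx A B) (succ approx A B) (succ approx B A)) /\
  (forall A (T : seq nat -> seq nat), inW A ->
     (forall a a', A a -> A a' -> T a = T a' -> a = a') ->
     (forall a, A a -> perm_eq (T a) a) ->
     approx A (pimage T A)) /\
  (forall A n, inW A -> approx (pprod A (psing n)) A) /\
  (forall A B A' B', inW A -> inW B -> inW A' -> inW B' ->
     multipliable A B -> multipliable A' B' -> approx A A' -> approx B B' ->
     approx (pprod A B) (pprod A' B')).

Definition strict_linear_order (N : Type) (lt : N -> N -> Prop) : Prop :=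
  (forall a, ~ lt a a) /\
  (forall a b c, lt a b -> lt b c -> lt a c) /\
  (forall a b, lt a b \/ a = b \/ lt b a).

Definition compatible_structure (approx : pset -> pset -> Prop) (N : Type)
    (nn : pset -> N) (add mul : N -> N -> N) (lt : N -> N -> Prop) : Prop :=
  strict_linear_order lt /\
  forall X Y, inW X -> inW Y ->
    (pdisjoint X Y -> add (nn X) (nn Y) = nn (punion X Y)) /\
    (multipliable X Y -> mul (nn X) (nn Y) = nn (pprod X Y)) /\
    (lt (nn X) (nn Y) <-> exists Y', inW Y' /\ pproper X Y' /\ approx Y Y').

(* Main.v *)
(* The difficulty is to find, in given classes, representatives that are disjoint
   from a prescribed set, or multipliable.  Both come from one remark: a tuple
   [a] may be replaced by [a 1 0^(k a + 1)], where [k] is bounded on the tuples of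
   the set with entries at most [n], for every [n].  Indeed, for [B] the set of
   all [a 1 0^j] with [j <= k a], (UP) gives [B x {0} ~ B], and (AP) cancels the
   common part, leaving the padded set and [A x {1} ~ A].  A fast growing [k]
   moves the set off any given set of [W]; with [k a = size a], reversing the
   tuples turns the set into the prefix code of the [0^(|a| + 1) 1 rev a], which
   is multipliable with every set.  The classes then form a cancellative
   semiring, totally ordered by (ZP), and the ring is its ring of differences. *)

Require Import Defs.
From HB Require Import structures.
From mathcomp Require Import all_boot all_order all_algebra.
From mathcomp Require Import boolp ring zify.
Import Order.TTheory GRing.Theory Num.Theory.

Set Implicit Arguments. Unset Strict Implicit. Unset Printing Implicit Defensive.

(** * The ring of differences of an ordered cancellative semiring *)

Section DifferenceRing.

Local Open Scope ring_scope.
Local Open Scope quotient_scope.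

(** The axioms of the non-negative part of an ordered domain. The order enters only through its
    algebraic form: [b] is above [a] when [a + d = b] has a solution [d]. *)
Record positive_cone := PositiveCone {
  cone_sort :> comNzSemiRingType;
  cone_addIr : forall a b c : cone_sort, a + c = b + c -> a = b;
  cone_addr_eq0 : forall a b : cone_sort, a + b = 0 -> a = 0;
  cone_total : forall a b : cone_sort,
    (exists d, a + d = b) \/ (exists d, b + d = a);
  cone_mulf_eq0 : forall a b : cone_sort, a * b = 0 -> a = 0 \/ b = 0
}.

Definition diff_rel (S : positive_cone) : rel (S * S) :=
  fun p q => p.1 + q.2 == q.1 + p.2.

Lemma diff_rel_refl (S : positive_cone) : reflexive (@diff_rel S).
Proof. by move=> p; exact: eqxx. Qed.

Lemma diff_rel_sym (S : positive_cone) : symmetric (@diff_rel S).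
Proof. by move=> p q; rewrite /diff_rel eq_sym. Qed.

Lemma diff_rel_trans (S : positive_cone) : transitive (@diff_rel S).
Proof.
move=> [c d] [a b] [x y] /eqP /= e1 /eqP /= e2; apply/eqP => /=.
apply: (@cone_addIr _ _ _ (c + d)).
transitivity ((a + d) + (c + y)); first by ring.
by rewrite e1 e2; ring.
Qed.

Canonical diff_equiv (S : positive_cone) :=
  EquivRel (@diff_rel S) (@diff_rel_refl S) (@diff_rel_sym S) (@diff_rel_trans S).

Definition difference_ring (S : positive_cone) := {eq_quot diff_equiv S}.
HB.instance Definition _ (S : positive_cone) := Choice.on (difference_ring S).

Definition diff {S : positive_cone} (a b : S) : difference_ring S :=
  \pi_({eq_quot diff_equiv S}) (a, b).

Lemma eq_diff (S : positive_cone) (a b c d : S) :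
  diff a b = diff c d <-> a + d = c + b.
Proof.
split; first by move=> /eqP; rewrite /diff eqmodE => /eqP.
by move=> e; apply/eqP; rewrite /diff eqmodE; apply/eqP.
Qed.

Definition diff_fst {S : positive_cone} (x : difference_ring S) : S :=
  (repr (x : {eq_quot diff_equiv S})).1.
Definition diff_snd {S : positive_cone} (x : difference_ring S) : S :=
  (repr (x : {eq_quot diff_equiv S})).2.

Lemma diffK (S : positive_cone) (x : difference_ring S) :
  diff (diff_fst x) (diff_snd x) = x.
Proof. by rewrite /diff /diff_fst /diff_snd -surjective_pairing reprK. Qed.

Lemma diff_repr (S : positive_cone) (a b : S) :
  diff_fst (diff a b) + b = a + diff_snd (diff a b).
Proof. by apply/eq_diff; rewrite diffK. Qed.

Lemma diffP (S : positive_cone) (x : difference_ring S) :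
  exists a b, x = diff a b.
Proof. by exists (diff_fst x), (diff_snd x); rewrite diffK. Qed.

(** * Ring operations on differences *)

Definition diff_add {S : positive_cone} (x y : difference_ring S) :=
  diff (diff_fst x + diff_fst y) (diff_snd x + diff_snd y).
Definition diff_opp {S : positive_cone} (x : difference_ring S) :=
  diff (diff_snd x) (diff_fst x).
Definition diff_mul {S : positive_cone} (x y : difference_ring S) :=
  diff (diff_fst x * diff_fst y + diff_snd x * diff_snd y)
       (diff_fst x * diff_snd y + diff_snd x * diff_fst y).

Lemma diff_addE (S : positive_cone) (a b c d : S) :
  diff_add (diff a b) (diff c d) = diff (a + c) (b + d).
Proof.
apply/eq_diff; move: (diff_repr a b) (diff_repr c d).
move: (diff_fst _) (diff_snd _) => x y e1.
move: (diff_fst _) (diff_snd _) => z t e2.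
transitivity ((x + b) + (z + d)); first by ring.
by rewrite e1 e2; ring.
Qed.

Lemma diff_oppE (S : positive_cone) (a b : S) : diff_opp (diff a b) = diff b a.
Proof.
by apply/eq_diff; rewrite addrC -diff_repr addrC.
Qed.

Lemma diff_mulE (S : positive_cone) (a b c d : S) :
  diff_mul (diff a b) (diff c d) = diff (a * c + b * d) (a * d + b * c).
Proof.
apply/eq_diff; move: (diff_repr a b) (diff_repr c d).
move: (diff_fst _) (diff_snd _) => x y e1.
move: (diff_fst _) (diff_snd _) => z t e2.
(* The added terms make [x + b] and [z + d], the left sides of [e1] and [e2], appear as factors; a
   second regrouping after the rewriting produces both factors once more. *)
apply: (@cone_addIr _ _ _ (b * z + a * t)).
transitivity ((x + b) * z + y * t + a * d + b * c + a * t); first by ring.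
transitivity (a * c + b * (z + d) + x * t + y * z + a * t); last by ring.
rewrite e1 e2.
transitivity (a * (z + d) + y * z + y * t + b * c + a * t); first by ring.
transitivity (a * c + b * c + (x + b) * t + y * z + a * t); last by ring.
by rewrite e1 e2; ring.
Qed.

Lemma diff_addA (S : positive_cone) : associative (@diff_add S).
Proof.
move=> x y z; have [a [b ->]] := diffP x; have [c [d ->]] := diffP y.
by have [s [t ->]] := diffP z; rewrite !diff_addE !addrA.
Qed.

Lemma diff_addC (S : positive_cone) : commutative (@diff_add S).
Proof.
move=> x y; have [a [b ->]] := diffP x; have [c [d ->]] := diffP y.
by rewrite !diff_addE addrC [b + d]addrC.
Qed.

Lemma diff_add0 (S : positive_cone) : left_id (diff 0 0) (@diff_add S).
Proof. by move=> x; have [a [b ->]] := diffP x; rewrite diff_addE !add0r. Qed.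

Lemma diff_addN (S : positive_cone) :
  left_inverse (diff 0 0) (@diff_opp S) diff_add.
Proof.
move=> x; have [a [b ->]] := diffP x.
by rewrite diff_oppE diff_addE; apply/eq_diff; ring.
Qed.

HB.instance Definition _ (S : positive_cone) :=
  GRing.isZmodule.Build (difference_ring S)
    (@diff_addA S) (@diff_addC S) (@diff_add0 S) (@diff_addN S).

Lemma diff_mulA (S : positive_cone) : associative (@diff_mul S).
Proof.
move=> x y z; have [a [b ->]] := diffP x; have [c [d ->]] := diffP y.
have [s [t ->]] := diffP z; rewrite !diff_mulE; apply/eq_diff; ring.
Qed.

Lemma diff_mulC (S : positive_cone) : commutative (@diff_mul S).
Proof.
move=> x y; have [a [b ->]] := diffP x; have [c [d ->]] := diffP y.
by rewrite !diff_mulE; apply/eq_diff; ring.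
Qed.

Lemma diff_mul1 (S : positive_cone) : left_id (diff 1 0) (@diff_mul S).
Proof.
move=> x; have [a [b ->]] := diffP x.
by rewrite diff_mulE; apply/eq_diff; ring.
Qed.

Lemma diff_mulDl (S : positive_cone) :
  left_distributive (@diff_mul S) (@diff_add S).
Proof.
move=> x y z; have [a [b ->]] := diffP x; have [c [d ->]] := diffP y.
have [s [t ->]] := diffP z.
by rewrite !(diff_mulE, diff_addE); apply/eq_diff; ring.
Qed.

Lemma diff1_neq0 (S : positive_cone) : diff (1 : S) 0 != 0.
Proof.
by apply/eqP => /eq_diff /eqP; rewrite add0r addr0 oner_eq0.
Qed.

HB.instance Definition _ (S : positive_cone) :=
  GRing.Zmodule_isComNzRing.Build (difference_ring S)
    (@diff_mulA S) (@diff_mulC S) (@diff_mul1 S) (@diff_mulDl S)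
    (@diff1_neq0 S).

Definition cone_inj {S : positive_cone} (a : S) : difference_ring S := diff a 0.

Lemma cone_injD (S : positive_cone) (a b : S) :
  cone_inj (a + b) = cone_inj a + cone_inj b.
Proof. by rewrite [RHS]diff_addE addr0. Qed.

Lemma cone_injM (S : positive_cone) (a b : S) :
  cone_inj (a * b) = cone_inj a * cone_inj b.
Proof. by rewrite [RHS]diff_mulE; apply/eq_diff; ring. Qed.

Lemma cone_inj_inj (S : positive_cone) : injective (@cone_inj S).
Proof. by move=> a b /eq_diff; rewrite !addr0. Qed.

(** Totality of the cone solves [a + d = b] or [b + d = a], and the solution is the absolute value
    of the difference. Statements about the ring thus reduce, up to sign, to the cone. *)
Lemma cone_inj_sign (S : positive_cone) (x : difference_ring S) :
  exists c, x = cone_inj c \/ x = - cone_inj c.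
Proof.
have [a [b ->]] := diffP x.
have [[d <-]|[d <-]] := cone_total a b; exists d.
  by right; rewrite [RHS]diff_oppE; apply/eq_diff; ring.
by left; apply/eq_diff; ring.
Qed.

Lemma diff_mulf_eq0 (S : positive_cone) :
  GRing.integral_domain_axiom (difference_ring S).
Proof.
move=> x y.
have cone0 (c d : S) : cone_inj c * cone_inj d = 0 ->
    (cone_inj c == 0) || (cone_inj d == 0).
  rewrite -cone_injM => /(@cone_inj_inj S _ 0) /cone_mulf_eq0.
  by case=> ->; rewrite eqxx ?orbT.
have [c [->|->]] := cone_inj_sign x; have [d [->|->]] := cone_inj_sign y;
  rewrite ?(mulrN, mulNr) ?oppr_eq0 => /eqP; rewrite ?oppr_eq0 => /eqP;
  exact: cone0.
Qed.

Definition diff_unit {S : positive_cone} : {pred difference_ring S} :=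
  fun x => `[< exists y, y * x = 1 >].
(** The integral domain structure is built over a ring with inverses, so an inverse is chosen
    classically; a non-unit is its own inverse by convention. *)
Definition diff_inv {S : positive_cone} (x : difference_ring S) :=
  if pselect (exists y, y * x = 1) is left h then projT1 (cid h) else x.

Lemma diff_mulVx (S : positive_cone) :
  {in @diff_unit S, left_inverse 1 diff_inv *%R}.
Proof.
move=> x /asboolP ux; rewrite /diff_inv; case: pselect => // h.
exact: (projT2 (cid h)).
Qed.

Lemma diff_unitPl (S : positive_cone) (x y : difference_ring S) :
  y * x = 1 -> diff_unit x.
Proof. by move=> yx; apply/asboolP; exists y. Qed.

Lemma diff_invr_out (S : positive_cone) :
  {in [predC @diff_unit S], diff_inv =1 id}.
Proof.
by move=> x /asboolPn nux; rewrite /diff_inv; case: pselect.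
Qed.

HB.instance Definition _ (S : positive_cone) :=
  GRing.ComNzRing_hasMulInverse.Build (difference_ring S)
    (@diff_mulVx S) (@diff_unitPl S) (@diff_invr_out S).
HB.instance Definition _ (S : positive_cone) :=
  GRing.ComUnitRing_isIntegral.Build (difference_ring S) (@diff_mulf_eq0 S).

(** * The order on differences, with the cone as non-negative part *)

Definition diff_le {S : positive_cone} : rel (difference_ring S) :=
  fun x y => `[< exists c : S, y - x = cone_inj c >].
Definition diff_norm {S : positive_cone} (x : difference_ring S) :=
  if diff_le 0 x then x else - x.

Lemma diff_le0P (S : positive_cone) (x : difference_ring S) :
  reflect (exists c : S, x = cone_inj c) (diff_le 0 x).
Proof. by apply: (iffP (asboolP _)); rewrite subr0. Qed.

Lemma diff_le0D (S : positive_cone) (x y : difference_ring S) :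
  diff_le 0 x -> diff_le 0 y -> diff_le 0 (x + y).
Proof.
move=> /diff_le0P [a ->] /diff_le0P [b ->]; apply/diff_le0P.
by exists (a + b); rewrite cone_injD.
Qed.

Lemma diff_le0M (S : positive_cone) (x y : difference_ring S) :
  diff_le 0 x -> diff_le 0 y -> diff_le 0 (x * y).
Proof.
move=> /diff_le0P [a ->] /diff_le0P [b ->]; apply/diff_le0P.
by exists (a * b); rewrite cone_injM.
Qed.

Lemma diff_le_subr (S : positive_cone) (x y : difference_ring S) :
  diff_le 0 (y - x) = diff_le x y.
Proof. by rewrite /diff_le subr0. Qed.

Lemma diff_le0_anti (S : positive_cone) (x : difference_ring S) :
  diff_le 0 x -> diff_le x 0 -> x = 0.
Proof.
move=> /diff_le0P [a ->]; rewrite -diff_le_subr sub0r => /diff_le0P [b e].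
have /cone_addr_eq0 -> // : a + b = 0.
by apply: cone_inj_inj; rewrite cone_injD -e subrr.
Qed.

Lemma diff_le0_total (S : positive_cone) (x : difference_ring S) :
  diff_le 0 x || diff_le x 0.
Proof.
apply/orP; have [c [->|->]] := cone_inj_sign x.
  by left; apply/diff_le0P; exists c.
by right; rewrite -diff_le_subr sub0r opprK; apply/diff_le0P; exists c.
Qed.

Lemma diff_normN (S : positive_cone) (x : difference_ring S) :
  diff_norm (- x) = diff_norm x.
Proof.
rewrite /diff_norm opprK -[diff_le 0 (- x)]diff_le_subr.
have := diff_le0_total x; have := @diff_le0_anti S x.
rewrite -[diff_le x 0]diff_le_subr sub0r subr0.
(* If both [x] and [- x] are non-negative, antisymmetry gives [x = 0]; totality rules out that
   neither is; in the two mixed cases the norms agree by definition. *)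
by case: ifP => nx; case: ifP => px //= /(_ isT isT) ->; rewrite oppr0.
Qed.

Lemma diff_norm_ge0 (S : positive_cone) (x : difference_ring S) :
  diff_le 0 x -> diff_norm x = x.
Proof. by rewrite /diff_norm => ->. Qed.

HB.instance Definition _ (S : positive_cone) :=
  Num.IntegralDomain_isLeReal.Build (difference_ring S)
    (@diff_le0D S) (@diff_le0M S) (@diff_le0_anti S) (@diff_le_subr S)
    (@diff_le0_total S) (@diff_normN S)
    (@diff_norm_ge0 S) (fun x y => erefl).

Lemma cone_inj_ge0 (S : positive_cone) (x : difference_ring S) :
  0 <= x <-> exists c, cone_inj c = x.
Proof.
by split=> [/diff_le0P [c ->]|[c <-]]; last apply/diff_le0P; exists c.
Qed.

End DifferenceRing.

(** * Finitary sets and prefix codes *)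

Lemma inW_psubset (A B : pset) : psubset A B -> inW B -> inW A.
Proof.
move=> sAB [Bn0 Bfin]; split=> [a /sAB /Bn0 //|n].
by have [h Bh] := Bfin n; exists h => a /sAB /Bh.
Qed.

Lemma inW_pset0 : inW (fun=> False).
Proof. by split=> [|n] //; exists 0. Qed.

Lemma inW_pset1 (a : seq nat) : a <> [::] -> inW (fun c => c = a).
Proof. by move=> a0; split=> [_ -> //|n]; exists (size a) => _ ->. Qed.

Lemma inW_punion (A B : pset) : inW A -> inW B -> inW (punion A B).
Proof.
move=> [An0 Afin] [Bn0 Bfin]; split=> [a [/An0|/Bn0] //|n].
have [h Ah] := Afin n; have [k Bk] := Bfin n; exists (maxn h k).
by move=> a [/Ah Aa|/Bk Ba] le_an; rewrite leq_max ?Aa ?Ba ?orbT.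
Qed.

Lemma inW_pdiff (A B : pset) : inW A -> inW (pdiff A B).
Proof. by apply: inW_psubset => a []. Qed.

Lemma inW_pprod (A B : pset) : inW A -> inW B -> inW (pprod A B).
Proof.
move=> [An0 Afin] [Bn0 Bfin]; split=> [c|n].
  by move=> [a [b [/An0]]]; case: a => // x a _ [_ ->].
have [h Ah] := Afin n; have [k Bk] := Bfin n; exists (h + k).
move=> _ [a [b [Aa [Bb ->]]]]; rewrite all_cat size_cat => /andP [le_an le_bn].
by rewrite leq_add // (Ah, Bk).
Qed.

Lemma inW_psing (n : nat) : inW (psing n).
Proof. exact: inW_pset1. Qed.

Lemma inW_pimage_perm (T : seq nat -> seq nat) (A : pset) : inW A ->
  (forall a, A a -> perm_eq (T a) a) -> inW (pimage T A).
Proof.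
move=> [An0 Afin] permT; split=> [_ [a [Aa ->]] Ta0|n].
  by apply: (An0 _ Aa); apply: size0nil; rewrite -(perm_size (permT _ Aa)) Ta0.
have [h Ah] := Afin n; exists h => _ [a [Aa ->]].
by rewrite (perm_all _ (permT _ Aa)) (perm_size (permT _ Aa)); apply: Ah.
Qed.

Lemma pset_eq0 (A : pset) : A = (fun=> False) \/ exists a, A a.
Proof.
have [|nA] := pselect (exists a, A a); [by right | left].
by apply/predeqP => a; split=> // Aa; apply: nA; exists a.
Qed.

(** * Padded words and prefix codes *)

Lemma nseq_marker_inj (i j : nat) (u v : seq nat) :
  nseq i 0 ++ 1 :: u = nseq j 0 ++ 1 :: v -> i = j /\ u = v.
Proof.
elim: i j => [|i IHi] [|j] //= []; first by move=> ->.
by move=> /IHi [-> ->].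
Qed.

(** The marker 1 separates the zeros added from those that may end [a], so [a] and [j] can be read
    off from the right. *)
Definition padding (a : seq nat) (j : nat) : seq nat := a ++ 1 :: nseq j 0.

Lemma padding_inj (a b : seq nat) (i j : nat) :
  padding a i = padding b j -> a = b /\ i = j.
Proof.
move=> /(congr1 rev); rewrite /padding !rev_cat !rev_cons !rev_nseq !cat_rcons.
by move=> /nseq_marker_inj [-> /(can_inj revK) ->].
Qed.

(** Multiplying a set of paddings by the singleton of 0 therefore shifts it by one layer. *)
Lemma rcons_padding (a : seq nat) (j : nat) :
  padding a j ++ [:: 0] = padding a j.+1.
Proof.
rewrite /padding -catA /= -[nseq j 0 ++ _]/(nseq j 0 ++ nseq 1 0).
by rewrite cat_nseq /ncons -iterD addn1.
Qed.

Definition padded (k : seq nat -> nat) (A : pset) : pset :=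
  fun c => exists a, A a /\ c = padding a (k a).+1.

(** This is what keeps padded sets finitary: only the letters 0 and 1 are added, and the number of
    zeros stays bounded on words with letters at most [n]. *)
Definition locally_bounded (A : pset) (k : seq nat -> nat) : Prop :=
  forall n, exists h, forall a, A a -> all (fun x => x <= n) a -> k a <= h.

Lemma inW_paddings (A : pset) (k : seq nat -> nat) :
  inW A -> locally_bounded A k ->
  inW (fun c => exists a j, A a /\ j <= k a /\ c = padding a j).
Proof.
move=> [An0 Afin] Ak; split=> [_ [a [j [_ [_ ->]]]]|n].
  by rewrite /padding; case: a.
have [h Ah] := Afin n; have [l kl] := Ak n; exists (h + l.+1).
move=> _ [a [j [Aa [jk ->]]]]; rewrite /padding all_cat size_cat /=.
move=> /andP [le_an _]; rewrite size_nseq leq_add ?Ah ?ltnS //.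
by rewrite (leq_trans jk) ?kl.
Qed.

Lemma inW_padded (A : pset) (k : seq nat -> nat) :
  inW A -> locally_bounded A k -> inW (padded k A).
Proof.
move=> wA Ak; have Ak1 : locally_bounded A (fun a => (k a).+1).
  by move=> n; have [h kh] := Ak n; exists h.+1 => a; exact: kh.
by apply: (inW_psubset _ (inW_paddings wA Ak1)) => c [a [Aa ->]];
  exists a, (k a).+1.
Qed.

Definition code (A : pset) : pset := pimage rev (padded size A).

Lemma code_elt (A : pset) (c : seq nat) : code A c ->
  exists a, A a /\ c = nseq (size a).+1 0 ++ 1 :: rev a.
Proof.
move=> [_ [[a [Aa ->]] ->]]; exists a; split=> //.
by rewrite /padding rev_cat rev_cons rev_nseq cat_rcons.
Qed.

Lemma locally_bounded_size (A : pset) : inW A -> locally_bounded A size.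
Proof. by case. Qed.

Lemma inW_code (A : pset) : inW A -> inW (code A).
Proof.
move=> wA; apply: inW_pimage_perm => [|a _]; last by rewrite perm_rev.
exact: inW_padded (locally_bounded_size wA).
Qed.

(** The tails [b] and [b'] are arbitrary words, so this is the usual condition that no word of [A]
    is a proper prefix of another. *)
Definition prefix_code (A : pset) : Prop := forall a a' b b',
  A a -> A a' -> a ++ b = a' ++ b' -> a = a' /\ b = b'.

Lemma prefix_code_multipliable (A B : pset) : prefix_code A -> multipliable A B.
Proof. by move=> pA a b a' b' Aa _ Aa' _; apply: pA. Qed.

(** The block of zeros before the marker gives the length of [a], hence the place where [rev a]
    ends. *)
Lemma prefix_code_code (A : pset) : prefix_code (code A).
Proof.
move=> _ _ b b' /code_elt [a [Aa ->]] /code_elt [a' [Aa' ->]].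
rewrite -!catA => /(@nseq_marker_inj _ _ (rev a ++ b) (rev a' ++ b')).
move=> [[eq_sz] /eqP].
by rewrite eqseq_cat ?size_rev // => /andP [/eqP -> /eqP ->]; rewrite eq_sz.
Qed.

Lemma prefix_code_pprod (A B : pset) :
  prefix_code A -> prefix_code B -> prefix_code (pprod A B).
Proof.
move=> pA pB _ _ c c' [a [b [Aa [Bb ->]]]] [a' [b' [Aa' [Bb' ->]]]].
rewrite -!catA => /(pA _ _ _ _ Aa Aa') [-> /(pB _ _ _ _ Bb Bb')].
by case=> -> ->.
Qed.

(* The leading zeros of a code word tell its length, so rotating by that length
   exchanges the factors of [code A] times [B]. *)
Definition swap_code (c : seq nat) : seq nat := rot (index 1 c).*2 c.

Lemma swap_codeE (A : pset) (x y : seq nat) :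
  code A x -> swap_code (x ++ y) = y ++ x.
Proof.
move=> /code_elt [a [_ ->]]; set x' := nseq _ _ ++ _.
suff -> : swap_code (x' ++ y) = rot (size x') (x' ++ y) by rewrite rot_size_cat.
congr rot; rewrite -catA index_cat mem_nseq /= size_nseq addn0.
(* A code word has [size a + 1] zeros, the marker and [size a] letters, so its length is exactly
   twice the index of its first 1. *)
by rewrite size_cat /= size_nseq size_rev; lia.
Qed.

Lemma pprodA (A B C : pset) : pprod A (pprod B C) = pprod (pprod A B) C.
Proof.
apply/predeqP => d; split.
  move=> [a [_ [Aa [[b [c [Bb [Cc ->]]]] ->]]]].
  by exists (a ++ b), c; rewrite catA; split; [exists a, b | split].
move=> [_ [c [[a [b [Aa [Bb ->]]]] [Cc ->]]]].
by exists a, (b ++ c); rewrite catA; split=> //; split=> //; exists b, c.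
Qed.

Lemma pprod_unionr (A B C : pset) :
  pprod A (punion B C) = punion (pprod A B) (pprod A C).
Proof.
apply/predeqP => d; split.
  by move=> [a [b [Aa [[Bb|Cb] ->]]]]; [left | right]; exists a, b.
by move=> [] [a [b [Aa [Hb ->]]]]; exists a, b; split=> //; split=> //;
  [left | right].
Qed.

Lemma pprod_unionl (A B C : pset) :
  pprod (punion A B) C = punion (pprod A C) (pprod B C).
Proof.
apply/predeqP => d; split.
  by move=> [a [b [[Aa|Ba] [Cb ->]]]]; [left | right]; exists a, b.
by move=> [] [a [b [Ha [Cb ->]]]]; exists a, b; split=> //; [left | right].
Qed.

Lemma multipliable_psing (A : pset) (n : nat) : multipliable A (psing n).
Proof.
move=> a _ a' _ Aa -> Aa' ->; rewrite !cats1 => /rcons_inj [->].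
by split.
Qed.

(** Last letters serve as tags: by (UP) they do not change the class, and distinct tags force
    disjointness. *)
Lemma pdisjoint_psing (A B : pset) (m n : nat) : m <> n ->
  pdisjoint (pprod A (psing m)) (pprod B (psing n)).
Proof.
move=> mn _ [[a [_ [Aa [-> ->]]]] [b [_ [Bb [->]]]]].
by rewrite !cats1 => /rcons_inj [_].
Qed.

(** * Arithmetic of an equinumerosity *)

Section Equinumerosity.

Variable approx : pset -> pset -> Prop.
Hypothesis heq : equinumerosity approx.

Lemma approx_refl A : inW A -> approx A A.
Proof. by case: heq => + _; apply. Qed.

Lemma approx_sym A B : inW A -> inW B -> approx A B -> approx B A.
Proof. by case: heq => _ [+ _]; apply. Qed.

Lemma approx_trans A B C : inW A -> inW B -> inW C ->
  approx A B -> approx B C -> approx A C.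
Proof. by case: heq => _ [_ [+ _]]; apply. Qed.

Lemma approx_diff A B : inW A -> inW B ->
  approx A B <-> approx (pdiff A B) (pdiff B A).
Proof. by case: heq => _ [_ [_ [+ _]]]; apply. Qed.

Lemma approx_trichotomy A B : inW A -> inW B ->
  exactly_one (approx A B) (succ approx A B) (succ approx B A).
Proof. by case: heq => _ [_ [_ [_ [+ _]]]]; apply. Qed.

Lemma approx_perm A (T : seq nat -> seq nat) : inW A ->
  (forall a a', A a -> A a' -> T a = T a' -> a = a') ->
  (forall a, A a -> perm_eq (T a) a) -> approx A (pimage T A).
Proof. by case: heq => _ [_ [_ [_ [_ [+ _]]]]]; apply. Qed.

Lemma approx_prod1 A n : inW A -> approx (pprod A (psing n)) A.
Proof. by case: heq => _ [_ [_ [_ [_ [_ [+ _]]]]]]; apply. Qed.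

Lemma approx_prod A B A' B' : inW A -> inW B -> inW A' -> inW B' ->
  multipliable A B -> multipliable A' B' -> approx A A' -> approx B B' ->
  approx (pprod A B) (pprod A' B').
Proof. by case: heq => _ [_ [_ [_ [_ [_ [_ +]]]]]]; apply. Qed.

Lemma approx_padded A k : inW A -> locally_bounded A k ->
  approx A (padded k A).
Proof.
move=> wA Ak.
pose B : pset := fun c => exists a j, A a /\ j <= k a /\ c = padding a j.
have wB : inW B by exact: inW_paddings.
have wB0 : inW (pprod B (psing 0)) by apply: inW_pprod wB (inW_psing 0).
have wA1 : inW (pprod A (psing 1)) by apply: inW_pprod wA (inW_psing 1).
have wP := inW_padded wA Ak.
have B0E c : pprod B (psing 0) c <->
    exists a j, A a /\ j <= k a /\ c = padding a j.+1.
  split=> [[_ [_ [[a [j [Aa [jk ->]]]] [-> ->]]]]|[a [j [Aa [jk ->]]]]].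
    by exists a, j; rewrite rcons_padding.
  exists (padding a j), [:: 0]; rewrite rcons_padding.
  by split=> //; exists a, j.
(* The shift by one layer loses only the bottom layer [j = 0], the words of [A] followed by the
   marker. *)
have eqA1 : pdiff B (pprod B (psing 0)) = pprod A (psing 1).
  apply/predeqP => c; split.
    move=> [[a [j [Aa [jk ->]]]] nB0]; exists a, [:: 1]; split=> //.
    split=> //; case: j jk nB0 => // j jk []; apply/B0E.
    by exists a, j; rewrite (ltnW jk).
  move=> [a [_ [Aa [-> ->]]]]; split; first by exists a, 0.
  by move=> /B0E [b [j [_ [_ /(@padding_inj _ _ 0) []]]]].
(* It gains only the top layer [j = k a + 1], whence the successor in [padded]. *)
have eqP1 : pdiff (pprod B (psing 0)) B = padded k A.
  apply/predeqP => c; split.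
    move=> [/B0E [a [j [Aa [jk ->]]]] nB]; exists a; split=> //.
    move: jk; rewrite leq_eqVlt => /orP [/eqP -> //|jk].
    by case: nB; exists a, j.+1.
  move=> [a [Aa ->]]; split; first by apply/B0E; exists a, (k a).
  by move=> [b [j [_ [jk /padding_inj [eab ej]]]]]; rewrite -ej eab ltnn in jk.
have := approx_sym wB0 wB (approx_prod1 0 wB).
move=> /(approx_diff wB wB0); rewrite eqA1 eqP1.
by apply: approx_trans => //; apply: approx_sym => //; apply: approx_prod1.
Qed.

Lemma approx_code A : inW A -> approx A (code A).
Proof.
move=> wA; have sA := locally_bounded_size wA.
apply: (@approx_trans _ (padded size A)) (approx_padded wA sA) _ => //.
- exact: inW_padded.
- exact: inW_code.
apply: approx_perm; first exact: inW_padded.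
  by move=> a a' _ _; apply: (can_inj revK).
by move=> a _; rewrite perm_rev.
Qed.

(** The exchange of factors is a permutation of coordinates on each word, so (TP) applies; it is
    injective because [code B], which comes first after the exchange, is a prefix code. *)
Lemma approx_pprodC A B : inW A -> inW B ->
  approx (pprod (code A) (code B)) (pprod (code B) (code A)).
Proof.
move=> wA wB; have wAB := inW_pprod (inW_code wA) (inW_code wB).
suff <- : pimage swap_code (pprod (code A) (code B)) = pprod (code B) (code A).
  apply: approx_perm => //.
    move=> _ _ [a [b [Aa [Bb ->]]]] [a' [b' [Aa' [Bb' ->]]]].
    by rewrite !(@swap_codeE A) // => /(prefix_code_code Bb Bb') [-> ->].
  by move=> c _; rewrite perm_rot.
apply/predeqP => c; split.
  move=> [_ [[a [b [Aa [Bb ->]]]] ->]].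
  by exists b, a; rewrite (@swap_codeE A).
move=> [b [a [Bb [Aa ->]]]]; exists (a ++ b).
by rewrite (@swap_codeE A) //; split=> //; exists a, b.
Qed.

Lemma approx_punion A B A' B' : inW A -> inW B -> inW A' -> inW B' ->
  pdisjoint A B -> pdisjoint A' B' -> approx A A' -> approx B B' ->
  approx (punion A B) (punion A' B').
Proof.
(* When [Y] is disjoint from both [X] and [X'], it disappears from the two set differences, and (AP)
   applies directly. In general [A'] may meet [B], which is why tags are used below. *)
have replace_left X X' Y : inW X -> inW X' -> inW Y -> pdisjoint X Y ->
    pdisjoint X' Y -> approx X X' -> approx (punion X Y) (punion X' Y).
  move=> wX wX' wY dXY dX'Y /(approx_diff wX wX') XX'.
  apply/approx_diff; try exact: inW_punion.
  suff diffU U V : pdisjoint U Y -> pdiff (punion U Y) (punion V Y) = pdiff U V.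
    by rewrite !diffU.
  move=> dUY; apply/predeqP => c; split.
    by move=> [[Uc|Yc] nVY]; [split=> // Vc|]; case: nVY; [left | right].
  by move=> [Uc nV]; split; [left | move=> [//|Yc]; apply: (dUY c)].
have punionC X Y : punion X Y = punion Y X.
  by apply/predeqP => c; split=> [] []; [right|left|right|left].
move=> wA wB wA' wB' dAB dA'B' AA' BB'.
have w1 X n : inW X -> inW (pprod X (psing n)).
  by move=> wX; apply: inW_pprod wX (inW_psing n).
have w2 X Y m n : inW X -> inW Y ->
    inW (punion (pprod X (psing m)) (pprod Y (psing n))).
  by move=> wX wY; apply: inW_punion; apply: w1.
have shift X m n : inW X -> approx (pprod X (psing m)) (pprod X (psing n)).
  move=> wX; apply: (@approx_trans _ X) => //; try exact: w1.
    exact: approx_prod1.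
  by apply: approx_sym; [exact: w1 | | exact: approx_prod1].
(* Tagging the two summands by the last letters 0 and 1 reduces to replacing
   one summand at a time. *)
have split X Y : inW X -> inW Y -> pdisjoint X Y ->
    approx (punion X Y) (punion (pprod X (psing 0)) (pprod Y (psing 1))).
  move=> wX wY dXY; have wXY := inW_punion wX wY.
  apply: (@approx_trans _ (pprod (punion X Y) (psing 2))) => //; try exact: w1.
  - exact: w2.
  - by apply: approx_sym; [exact: w1 | | exact: approx_prod1].
  (* All words now end in 2. The tag becomes 0 on the part from [X], then 1 on the part from [Y];
     the two parts remain disjoint throughout. *)
  rewrite pprod_unionl.
  apply: (@approx_trans _ (punion (pprod X (psing 0)) (pprod Y (psing 2))));
    try exact: w2.
    apply: replace_left; try exact: w1.
    - move=> _ [[a [_ [Xa [-> ->]]]] [b [_ [Yb [->]]]]].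
      rewrite !cats1 => /rcons_inj [eab].
      by apply: (dXY b); rewrite -{1}eab.
    - exact: pdisjoint_psing.
    - exact: shift.
  rewrite punionC [X in approx _ X]punionC.
  by apply: replace_left; try exact: w1; try exact: pdisjoint_psing; apply: shift.
apply: (approx_trans _ _ _ (split _ _ wA wB dAB));
  try exact: inW_punion; try exact: w2.
apply: approx_sym; try exact: inW_punion; try exact: w2.
apply: (approx_trans _ _ _ (split _ _ wA' wB' dA'B'));
  try exact: inW_punion; try exact: w2.
have tag X X' n : inW X -> inW X' -> approx X X' ->
    approx (pprod X' (psing n)) (pprod X (psing n)).
  move=> wX wX' XX'; apply: approx_prod; rewrite -/(psing n) //;
    try exact: inW_psing; try exact: multipliable_psing.
    exact: approx_sym.
  exact: approx_refl (inW_psing n).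
(* The mixed union differs from each end in a single summand, and the tags provide the disjointness
   that [replace_left] asks for. *)
apply: (@approx_trans _ (punion (pprod A (psing 0)) (pprod B' (psing 1))));
  try exact: w2.
  by apply: replace_left; try exact: w1; try exact: pdisjoint_psing; apply: tag.
rewrite punionC [X in approx _ X]punionC.
by apply: replace_left; try exact: w1; try exact: pdisjoint_psing; apply: tag.
Qed.

(** Cancellation is the other direction of (AP): the differences of the two unions are [A] and [B]
    themselves. *)
Lemma approx_punionr A B C : inW A -> inW B -> inW C ->
  pdisjoint A B -> pdisjoint A C -> pdisjoint B C ->
  approx (punion A C) (punion B C) -> approx A B.
Proof.
move=> wA wB wC dAB dAC dBC.
move=> /(approx_diff (inW_punion wA wC) (inW_punion wB wC)).
suff diffU X Y : pdisjoint X Y -> pdisjoint X C ->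
    pdiff (punion X C) (punion Y C) = X.
  by rewrite !diffU // => c [Bc Ac]; apply: (dAB c).
move=> dXY dXC; apply/predeqP => c; split.
  by move=> [[//|Cc] []]; right.
by move=> Xc; split; [left | move=> [Yc|Cc]; [apply: (dXY c)|apply: (dXC c)]].
Qed.

(** A non-empty set properly contains the empty one, so it succeeds it, and (ZP) then excludes
    equivalence. *)
Lemma not_approx0 A : inW A -> approx A (fun=> False) -> A = (fun=> False).
Proof.
move=> wA A0; have w0 := inW_pset0.
have [//|[a Aa]] := pset_eq0 A.
have [_ [nA _]] := approx_trichotomy wA w0; case: nA; split=> //.
exists A, (fun=> False); split=> //; split=> //; split; last first.
  by split; apply: approx_refl.
by split=> [c []|]; exists a; split=> //; case.
Qed.

(** Padding makes each word longer than any word of [X] with letters under the same bound. *)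
Lemma disjoint_copy A X : inW A -> inW X ->
  exists A', inW A' /\ approx A A' /\ pdisjoint A' X.
Proof.
move=> wA [_ Xfin].
have [h Xh] := choice Xfin.
pose m (a : seq nat) := maxn 1 (\max_(x <- a) x).
(* The maximum with 1 in [m] lets [m a] bound the marker as well as the letters of [a]. *)
have le_m a : all (fun x => x <= m a) a.
  by apply/allP => x xa; rewrite leq_max (@leq_bigmax_seq _ _ xpredT id) ?orbT.
have m_le a n : all (fun x => x <= n) a -> m a <= maxn 1 n.
  move=> /allP an; rewrite geq_max leq_maxl leq_max; apply/orP; right.
  by apply/bigmax_leqP_seq => x xa _; apply: an.
pose k a := h (m a).
have Ak : locally_bounded A k.
  (* The function [h] comes from choice and may fail to be monotone; the sum bounds all of its
     values up to [maxn 1 n]. *)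
  move=> n; exists (\sum_(i < (maxn 1 n).+1) h i) => a _ /m_le ma.
  by rewrite (bigD1 (Ordinal (ma : m a < _.+1))) //= leq_addr.
exists (padded k A); split; first exact: inW_padded.
split; first exact: approx_padded.
move=> _ [[a [Aa ->]] Xa].
have := Xh (m a) _ Xa; rewrite /padding all_cat le_m size_cat /= all_nseq.
rewrite leq_maxl orbT size_nseq -/(k a) => /(_ isT); lia.
Qed.

(** * The ordered semiring of classes *)

Variables (N : Type) (nn : pset -> N).
Hypothesis nnE : forall X Y, inW X -> inW Y -> (nn X = nn Y <-> approx X Y).
Hypothesis nn_surj : forall c : N, exists X, inW X /\ nn X = c.

Definition rep (c : N) : pset := projT1 (cid (nn_surj c)).

Lemma inW_rep c : inW (rep c).
Proof. by rewrite /rep; case: cid => X []. Qed.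

Lemma repK c : nn (rep c) = c.
Proof. by rewrite /rep; case: cid => X []. Qed.

Definition num0 : N := nn (fun=> False).
Definition num1 : N := nn (psing 0).
(** Tags make the chosen representatives disjoint; in the product below, coding the left factor
    makes them multipliable. *)
Definition num_add (a b : N) : N :=
  nn (punion (pprod (rep a) (psing 0)) (pprod (rep b) (psing 1))).
Definition num_mul (a b : N) : N := nn (pprod (code (rep a)) (rep b)).

Lemma nn_prod1 X n : inW X -> nn (pprod X (psing n)) = nn X.
Proof.
move=> wX; apply/nnE => //; first exact: inW_pprod wX (inW_psing n).
exact: approx_prod1.
Qed.

Lemma nn_code X : inW X -> nn (code X) = nn X.
Proof.
by move=> wX; apply/esym/nnE => //; [apply: inW_code | apply: approx_code].
Qed.

Lemma nn_punion X Y : inW X -> inW Y -> pdisjoint X Y ->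
  num_add (nn X) (nn Y) = nn (punion X Y).
Proof.
move=> wX wY dXY; have w1 Z n : inW Z -> inW (pprod Z (psing n)).
  by move=> wZ; apply: inW_pprod wZ (inW_psing n).
have [wx wy] := (inW_rep (nn X), inW_rep (nn Y)).
apply/nnE; [by apply: inW_punion; apply: w1 | exact: inW_punion |].
apply: approx_punion => //; try exact: w1; first exact: pdisjoint_psing.
  by apply/nnE; [exact: w1 | | rewrite nn_prod1 // repK].
by apply/nnE; [exact: w1 | | rewrite nn_prod1 // repK].
Qed.

Lemma nn_pprod X Y : inW X -> inW Y -> multipliable X Y ->
  num_mul (nn X) (nn Y) = nn (pprod X Y).
Proof.
move=> wX wY mXY; have [wx wy] := (inW_rep (nn X), inW_rep (nn Y)).
apply/nnE; try exact: inW_pprod; first exact: inW_pprod (inW_code wx) wy.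
apply: approx_prod => //; first exact: inW_code.
- by apply: prefix_code_multipliable; apply: prefix_code_code.
- by apply/nnE => //; [exact: inW_code | rewrite nn_code // repK].
- by apply/nnE => //; rewrite repK.
Qed.

(** On such representatives the laws of addition become identities between unions. *)
Lemma disjoint_reps (a b c : N) : exists X Y Z, [/\ inW X, inW Y & inW Z] /\
  [/\ pdisjoint X Y, pdisjoint X Z & pdisjoint Y Z] /\
  [/\ nn X = a, nn Y = b & nn Z = c].
Proof.
exists (pprod (rep a) (psing 0)), (pprod (rep b) (psing 1)),
  (pprod (rep c) (psing 2)).
split; first by split; apply: inW_pprod (inW_rep _) (inW_psing _).
split; first by split; apply: pdisjoint_psing.
by rewrite !nn_prod1 ?repK //; apply: inW_rep.
Qed.

Lemma code_rep (a : N) : exists X, [/\ inW X, prefix_code X & nn X = a].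
Proof.
exists (code (rep a)); split; first exact: inW_code (inW_rep a).
  exact: prefix_code_code.
by rewrite nn_code ?repK //; apply: inW_rep.
Qed.

Lemma num_addA : associative num_add.
Proof.
move=> a b c.
have [X [Y [Z [[wX wY wZ] [[dXY dXZ dYZ] [<- <- <-]]]]]] := disjoint_reps a b c.
have [wYZ wXY] := (inW_punion wY wZ, inW_punion wX wY).
rewrite !nn_punion //.
- by congr nn; apply/predeqP => d; rewrite /punion; tauto.
- by move=> d [[Xd|Yd] Zd]; [apply: (dXZ d) | apply: (dYZ d)].
- by move=> d [Xd [Yd|Zd]]; [apply: (dXY d) | apply: (dXZ d)].
Qed.

Lemma num_addC : commutative num_add.
Proof.
move=> a b.
have [X [Y [_ [[wX wY _] [[dXY _ _] [<- <- _]]]]]] := disjoint_reps a b a.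
rewrite !nn_punion //; last by move=> d [Yd Xd]; apply: (dXY d).
by congr nn; apply/predeqP => d; rewrite /punion; tauto.
Qed.

Lemma num_add0 : left_id num0 num_add.
Proof.
move=> a; have [X [wX <-]] := nn_surj a.
rewrite nn_punion //; [|exact: inW_pset0 | by move=> d []].
by congr nn; apply/predeqP => d; rewrite /punion; tauto.
Qed.

Lemma num_addIr a b c : num_add a c = num_add b c -> a = b.
Proof.
have [X [Y [Z [[wX wY wZ] [[dXY dXZ dYZ] [<- <- <-]]]]]] := disjoint_reps a b c.
rewrite !nn_punion // => /nnE eqU; apply/nnE => //.
by apply: (@approx_punionr _ _ Z) => //; apply: eqU; apply: inW_punion.
Qed.

Lemma nn_eq0 X : inW X -> nn X = num0 -> X = (fun=> False).
Proof.
move=> wX /nnE X0; apply: not_approx0 => //.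
by apply: X0 => //; apply: inW_pset0.
Qed.

Lemma num_add_eq0 a b : num_add a b = num0 -> a = num0.
Proof.
have [X [Y [_ [[wX wY _] [[dXY _ _] [<- <- _]]]]]] := disjoint_reps a b a.
rewrite nn_punion // => /nn_eq0 U0; congr nn.
apply/predeqP => d; split=> // Xd.
by have /predeqP /(_ d) [+ _] := U0 (inW_punion wX wY); apply; left.
Qed.

Lemma nn_pproper X Y : inW X -> inW Y -> pproper X Y ->
  exists d, d <> num0 /\ num_add (nn X) d = nn Y.
Proof.
move=> wX wY [sXY [a [Ya nXa]]]; have wD := inW_pdiff X wY.
exists (nn (pdiff Y X)); split.
  by move=> /(nn_eq0 wD) /predeqP /(_ a) [+ _]; apply.
rewrite nn_punion //; last by move=> d [Xd []].
congr nn; apply/predeqP => d; rewrite /punion /pdiff; split=> [[/sXY|[]]//|Yd].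
by have [Xd|nXd] := pselect (X d); [left | right].
Qed.

Definition num_lt (a b : N) : Prop := exists d, d <> num0 /\ num_add a d = b.

Lemma num_total a b : num_lt a b \/ a = b \/ num_lt b a.
Proof.
have [[X [wX <-]] [Y [wY <-]]] := (nn_surj a, nn_surj b).
have num_lt_succ U V : inW U -> inW V -> succ approx U V -> num_lt (nn V) (nn U).
  move=> wU wV [U' [V' [wU' [wV' [pVU [UU' VV']]]]]].
  have /(nnE wU wU') -> := UU'; have /(nnE wV wV') -> := VV'.
  exact: nn_pproper.
have [[XY|[XY|YX]] _] := approx_trichotomy wX wY.
- by right; left; apply/nnE.
- by right; right; apply: num_lt_succ.
- by left; apply: num_lt_succ.
Qed.

Lemma num_ltP X Y : inW X -> inW Y ->
  num_lt (nn X) (nn Y) <-> exists Y', inW Y' /\ pproper X Y' /\ approx Y Y'.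
Proof.
move=> wX wY; split=> [[d [d0 dE]]|[Y' [wY' [XY' /nnE YY']]]]; last first.
  by rewrite YY' //; apply: nn_pproper.
have [D [wD Dd]] := nn_surj d.
(* The superset has to contain the given [X] itself, so only the summand can be moved away. *)
have [D' [wD' [DD' dD'X]]] := disjoint_copy wD wX.
have D'd : nn D' = d by rewrite -Dd; apply/esym/nnE.
exists (punion X D'); split; first exact: inW_punion.
split; last first.
  apply/nnE => //; first exact: inW_punion.
  by rewrite -nn_punion // ?D'd // => c [Xc D'c]; apply: (dD'X c).
split=> [c Xc|]; first by left.
have [D'0|[c D'c]] := pset_eq0 D'; first by case: d0; rewrite -D'd D'0.
by exists c; split; [right | move=> Xc; apply: (dD'X c)].
Qed.

Lemma num_mulC : commutative num_mul.
Proof.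
move=> a b; have [[X [wX <-]] [Y [wY <-]]] := (nn_surj a, nn_surj b).
have [wX' wY'] := (inW_code wX, inW_code wY).
rewrite -(nn_code wX) -(nn_code wY) !nn_pprod //;
  try by apply: prefix_code_multipliable; apply: prefix_code_code.
by apply/nnE; try exact: inW_pprod; apply: approx_pprodC.
Qed.

Lemma num_mulA : associative num_mul.
Proof.
move=> a b c; have [Z [wZ <-]] := nn_surj c.
have [X [wX pX <-]] := code_rep a; have [Y [wY pY <-]] := code_rep b.
have [wXY wYZ] := (inW_pprod wX wY, inW_pprod wY wZ).
rewrite !nn_pprod ?pprodA //; apply: prefix_code_multipliable => //.
exact: prefix_code_pprod.
Qed.

Lemma num_mul1 : left_id num1 num_mul.
Proof.
move=> a; rewrite num_mulC; have [X [wX <-]] := nn_surj a.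
rewrite nn_pprod ?nn_prod1 //; first exact: inW_psing.
exact: multipliable_psing.
Qed.

(** Commutativity puts the common factor on the left, where it is taken as a prefix code: its word
    can then be stripped off, so the products with disjoint sets are disjoint. *)
Lemma num_mulDl : left_distributive num_mul num_add.
Proof.
move=> b c a; rewrite ![num_mul _ a]num_mulC.
have [Y [Z [_ [[wY wZ _] [[dYZ _ _] [<- <- _]]]]]] := disjoint_reps b c a.
have [X [wX pX <-]] := code_rep a; rewrite nn_punion //.
rewrite nn_pprod //; [|exact: inW_punion | exact: prefix_code_multipliable].
rewrite pprod_unionr !nn_pprod //; try exact: prefix_code_multipliable.
rewrite nn_punion //; try exact: inW_pprod.
move=> _ [[x [y [Xx [Yy ->]]]] [x' [z [Xx' [Zz]]]]].
by move=> /(pX _ _ _ _ Xx Xx') [_ eyz]; apply: (dYZ z); rewrite -{1}eyz.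
Qed.

Lemma num_mul0 : left_zero num0 num_mul.
Proof.
move=> a; apply: (@num_addIr _ _ (num_mul num0 a)).
by rewrite -num_mulDl !num_add0.
Qed.

Lemma num_mul_eq0 a b : num_mul a b = num0 -> a = num0 \/ b = num0.
Proof.
have [X [wX pX <-]] := code_rep a; have [Y [wY <-]] := nn_surj b.
rewrite nn_pprod //; last exact: prefix_code_multipliable.
move=> /nn_eq0 P0.
have [->|[x Xx]] := pset_eq0 X; first by left.
have [->|[y Yy]] := pset_eq0 Y; first by right.
have /predeqP /(_ (x ++ y)) [+ _] := P0 (inW_pprod wX wY).
by case; exists x, y.
Qed.

Lemma num1_neq0 : num1 <> num0.
Proof.
by move=> /(nn_eq0 (inW_psing 0)) /predeqP /(_ [:: 0]) [+ _]; apply.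
Qed.

Lemma nn_pset1 a : a <> [::] -> nn (fun c => c = a) = num1.
Proof.
have rcons1 b n : pprod (fun c => c = b) (psing n) = (fun c => c = rcons b n).
  apply/predeqP => c; rewrite -cats1; split=> [[_ [_ [-> [-> ->]]]] //|->].
  by exists b, [:: n].
have nn_rcons b n : b <> [::] ->
    nn (fun c => c = rcons b n) = nn (fun c => c = b).
  by move=> b0; rewrite -rcons1 nn_prod1 //; apply: inW_pset1.
have nn_cons b n : nn (fun c => c = rcons b n) = nn (fun c => c = n :: b).
  have w : inW (fun c => c = rcons b n) by apply: inW_pset1; case: b.
  apply/nnE => //; first exact: inW_pset1.
  suff <- : pimage (rotr 1) (fun c => c = rcons b n) = (fun c => c = n :: b).
    apply: approx_perm => //; first by move=> c c' _ _; apply: rotr_inj.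
    by move=> c _; rewrite perm_rotr.
  apply/predeqP => c; split=> [[_ [-> ->]]|->]; first by rewrite rotr1_rcons.
  by exists (rcons b n); rewrite rotr1_rcons.
have nn_cons0 b n : nn (fun c => c = n :: b) = nn (fun c => c = [:: n]).
  by elim/last_ind: b => [|b m IHb] //; rewrite -rcons_cons nn_rcons.
case: a => // n a _; rewrite nn_cons0.
(* The remaining letter is changed to 0 through the words [n], [n 0], [0 n], [0]. *)
rewrite -(nn_rcons [:: n] 0) // (nn_cons [:: n] 0).
by rewrite nn_cons0.
Qed.

(** Removing a point subtracts one: this gives both the discreteness of the order and the count of
    finite sets. *)
Lemma nn_num1_add X a : inW X -> X a ->
  num_add num1 (nn (pdiff X (fun c => c = a))) = nn X.
Proof.
move=> wX Xa; have a0 : a <> [::] by case: wX => + _; apply.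
rewrite -(nn_pset1 a0) nn_punion //.
- congr nn; apply/predeqP => c; split=> [[-> //|[]//]|Xc].
  by have [->|ca] := pselect (c = a); [left | right].
- exact: inW_pset1.
- exact: inW_pdiff.
- by move=> c [-> []].
Qed.

End Equinumerosity.

(** * From the classes to the ordered ring *)

Lemma numerosity_cone approx (heq : equinumerosity approx) N nn
    (nnE : forall X Y, inW X -> inW Y -> (nn X = nn Y <-> approx X Y))
    (nn_surj : forall c : N, exists X, inW X /\ nn X = c) :
  exists (S : positive_cone) (g : N -> S) (g' : S -> N),
    [/\ cancel g g' & cancel g' g] /\
    [/\ g (num0 nn) = 0%R, g (num1 nn) = 1%R,
        forall a b, g (num_add nn_surj a b) = (g a + g b)%R
      & forall a b, g (num_mul nn_surj a b) = (g a * g b)%R].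
Proof.
(* The alias [{classic N}] equips the bare type [N] with classical equality and choice; the maps [g]
   and [g'] are identities that pass between the two. *)
pose M : nmodType := HB.pack {classic N}
  (GRing.isNmodule.Build {classic N} (num_addA heq nnE nn_surj)
     (num_addC heq nnE nn_surj)
     (num_add0 heq nnE nn_surj)).
have num1_neq0b : num1 nn != 0%R :> M by apply/eqP; exact: (num1_neq0 heq nnE).
pose K : comNzSemiRingType := HB.pack {classic N} M
  (GRing.Nmodule_isComNzSemiRing.Build M
     (num_mulA heq nnE nn_surj) (num_mulC heq nnE nn_surj)
     (num_mul1 heq nnE nn_surj) (num_mulDl heq nnE nn_surj)
     (num_mul0 heq nnE nn_surj) num1_neq0b).
have Ktotal (a b : K) : (exists d, a + d = b)%R \/ (exists d, b + d = a)%R.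
  have [[d [_ <-]]|[->|[d [_ <-]]]] := num_total heq nnE nn_surj a b.
  - by left; exists d.
  - by left; exists 0%R; rewrite addr0.
  - by right; exists d.
pose S := @PositiveCone K (@num_addIr _ heq _ _ nnE nn_surj)
  (@num_add_eq0 _ heq _ _ nnE nn_surj) Ktotal
  (@num_mul_eq0 _ heq _ _ nnE nn_surj).
by exists S, id, id.
Qed.

Theorem theorem1p9 (approx : pset -> pset -> Prop) (N : Type) (nn : pset -> N) :
  equinumerosity approx ->
  (* (N, nn) is the quotient W / approx with its canonical map *)
  (forall X Y, inW X -> inW Y -> (nn X = nn Y <-> approx X Y)) ->
  (forall c : N, exists X, inW X /\ nn X = c) ->
  exists (add mul : N -> N -> N) (lt : N -> N -> Prop),
    compatible_structure approx nn add mul lt /\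
    (forall add' mul' lt', compatible_structure approx nn add' mul' lt' ->
       (forall a b, add' a b = add a b) /\ (forall a b, mul' a b = mul a b) /\
       (forall a b, lt' a b <-> lt a b)) /\
    exists (R : realDomainType) (f : N -> R),
      (* R is discretely ordered *)
      (forall x : R, (0 < x)%R -> (1 <= x)%R) /\
      (* f identifies N with the non-negative part of R *)
      injective f /\
      (forall x : R, (0 <= x)%R <-> exists c, f c = x) /\
      (forall a b, f (add a b) = (f a + f b)%R) /\
      (forall a b, f (mul a b) = (f a * f b)%R) /\
      (forall a b, lt a b <-> (f a < f b)%R) /\
      (* finite sets: nn X = |X| *)
      (forall (X : pset) (s : seq (seq nat)), inW X -> uniq s ->
         (forall a, X a <-> a \in s) -> f (nn X) = ((size s)%:R)%R).
Proof.
move=> heq nnE nn_surj.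
have [S [g [g' [[gK g'K] [g0 g1 gD gM]]]]] := numerosity_cone heq nnE nn_surj.
pose f (c : N) : difference_ring S := cone_inj (g c).
have fI : injective f by move=> a b /(@cone_inj_inj S) /(can_inj gK).
have f0 : f (num0 nn) = 0%R by rewrite /f g0.
have f1 : f (num1 nn) = 1%R by rewrite /f g1.
have fD a b : f (num_add nn_surj a b) = (f a + f b)%R.
  by rewrite /f gD cone_injD.
have fM a b : f (num_mul nn_surj a b) = (f a * f b)%R.
  by rewrite /f gM cone_injM.
have fge0 (x : difference_ring S) : (0 <= x)%R <-> exists c, f c = x.
  rewrite cone_inj_ge0; split=> [] [c <-]; last by exists (g c).
  by exists (g' c); rewrite /f g'K.
(* Both sides say that [f b - f a] is the image of a non-zero class. *)
have flt a b : num_lt nn_surj a b <-> (f a < f b)%R.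
  split=> [[d [d0 <-]]|].
    rewrite fD ltrDl lt0r; apply/andP; split; last by apply/fge0; exists d.
    by apply/eqP; rewrite -f0 => /fI.
  rewrite -subr_gt0 lt0r => /andP [/eqP ab /fge0 [d dE]]; exists d; split.
    by move=> d0; apply: ab; rewrite -dE d0 f0.
  by apply: fI; rewrite fD dE addrC subrK.
exists (num_add nn_surj), (num_mul nn_surj), (num_lt nn_surj).
split; last split; last exists (difference_ring S), f.
- split; last first.
    move=> X Y wX wY; split=> [dXY|]; first by rewrite (nn_punion heq nnE).
    split=> [mXY|]; first by rewrite (nn_pprod heq nnE).
    exact: (num_ltP heq nnE nn_surj wX wY).
  split; first by move=> a /flt; rewrite ltxx.
  split; first by move=> a b c /flt ab /flt bc; apply/flt; apply: lt_trans bc.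
  exact: (num_total heq nnE nn_surj).
(* Uniqueness: any two classes have disjoint representatives and multipliable ones, on which the
   conditions prescribe the values; for the order any representatives do. *)
- move=> add' mul' lt' [_ compat]; split.
    move=> a b.
    have [X [Y [_ [[wX wY _] [[dXY _ _] [<- <- _]]]]]] :=
      disjoint_reps heq nnE nn_surj a b a.
    by have [-> // _] := compat X Y wX wY; rewrite (nn_punion heq nnE).
  split=> a b.
    have [X [wX pX <-]] := code_rep heq nnE nn_surj a.
    have [Y [wY <-]] := nn_surj b.
    have mXY := @prefix_code_multipliable X Y pX.
    by have [_ [-> // _]] := compat X Y wX wY; rewrite (nn_pprod heq nnE).
  have [[X [wX <-]] [Y [wY <-]]] := (nn_surj a, nn_surj b).
  by have [_ [_ ->]] := compat X Y wX wY; rewrite (num_ltP heq nnE).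
- split.
    (* A positive element is the class of a non-empty set, and removing a point writes it as 1 plus
       a non-negative element. *)
    move=> x x0; have /fge0 [c cE] := ltW x0.
    have [X [wX Xc]] := nn_surj c.
    have [X0|[a Xa]] := pset_eq0 X.
      by move: x0; rewrite -cE -Xc X0 f0 ltxx.
    rewrite -cE -Xc -(nn_num1_add heq nnE nn_surj wX Xa) fD f1 lerDl.
    by apply/fge0; eexists.
  do 5 split => //; move=> X s.
  (* The set is generalized in the induction, since each listed point is removed from it in turn. *)
  elim: s X => [|a s IHs] X wX /= us Xs.
    have -> : X = (fun=> False) by apply/predeqP => a; rewrite Xs.
    exact: f0.
  have [/negP as_ us'] := andP us.
  have Xa : X a by apply/Xs; rewrite inE eqxx.
  rewrite -(nn_num1_add heq nnE nn_surj wX Xa) fD f1 -[in RHS]add1n natrD.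
  congr (_ + _)%R; apply: IHs => //; first exact: inW_pdiff.
  move=> c; split=> [[/Xs]|cs].
    by rewrite inE => /orP [/eqP //|].
  split; first by apply/Xs; rewrite inE cs orbT.
  by move=> ca; rewrite ca in cs.
Qed.
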